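(* Let $B = \{b_1 < b_2 < \dots\}$ be an infinite arithmetic progression of integers with common difference $d$ (so $b_n = b_1 + (n-1)d$), where $b_1 \in \{4, 7, 8\} \cup \{b \in \mathbb{N} : b \geq 11\}$. If $b_1 + 2 \leq d \leq 2b_1 + 1$, then there exists a sequence of positive integers $A = \{a_1 < a_2 < \dots\}$ such that $P(A) = \mathbb{N} \setminus B$.
   Context: $\mathbb{N}$ denotes the set of all nonnegative integers. For a set $A = \{a_1 < a_2 < \dots\}$ of positive integers, $P(A) = \{\sum \varepsilon_i a_i : a_i \in A, \varepsilon_i \in \{0,1\}, \sum \varepsilon_i < \infty\}$ is the set of all finite subset sums of $A$; in particular $0 \in P(A)$ (empty sum). *)

(* Defs.v *)
From mathcomp Require Import all_boot finmap.
From mathcomp Require Import classical_sets.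

Set Implicit Arguments.
Unset Strict Implicit.
Unset Printing Implicit Defensive.

Local Open Scope classical_set_scope.

(* P(A). A choice of coefficients in {0,1}, finitely many nonzero, is the
   choice of a finite S included in A; the empty S gives 0. *)
Definition subset_sums (A : set nat) : set nat :=
  [set n | exists2 S : {fset nat}, [set` S] `<=` A & n = \sum_(x <- S) x].

(* Main.v *)
Require Import Defs.
From mathcomp Require Import all_boot finmap zify.
From mathcomp Require Import classical_sets.

Local Open Scope classical_set_scope.

(**
  Write b for [b 0]. Since b < d, the progression is the residue class of b
  modulo d. For b = 4, 7, 8 or b >= 11 there is a finite set C of positive
  integers with P(C) = [0, b - 1]. Then C together with b + 1 has subset sums
  [0, 2b] minus b, which for b + 2 <= d <= 2b + 1 represent every residue
  modulo d except that of b. Adding the elements d, 2d, 4d, 8d, ... adjoins all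
  multiples of d.
*)

Lemma subset_sums_seqP (A : set nat) n :
  subset_sums A n <->
  exists s, [/\ uniq s, {in s, forall x, A x} & n = \sum_(x <- s) x].
Proof.
split=> [[S SA ->]|[s [us sA ->]]].
  by exists (enum_fset S); split=> [|x xS|]; [apply: fset_uniq | apply: SA |].
exists [fset x in s]%fset => [x /=|]; first by rewrite inE; apply: sA.
apply: perm_big; apply: uniq_perm => [||x]; rewrite ?inE ?fset_uniq //.
Qed.

(** A sum splits according to membership in [A]. Conversely, disjointness keeps the concatenation of
    two duplicate-free lists duplicate-free. *)
Lemma subset_sumsU (A B : set nat) n : A `&` B = set0 ->
  subset_sums (A `|` B) n <->
  exists x y, [/\ subset_sums A x, subset_sums B y & n = x + y].
Proof.
move=> AB0; split=> [/subset_sums_seqP[s [us sAB ->]]|].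
  exists (\sum_(x <- [seq x <- s | x \in A]) x).
  exists (\sum_(x <- [seq x <- s | x \notin A]) x); split.
  - apply/subset_sums_seqP; exists [seq x <- s | x \in A].
    split=> [||//]; first exact: filter_uniq.
    by move=> x; rewrite mem_filter => /andP[/set_mem].
  - apply/subset_sums_seqP; exists [seq x <- s | x \notin A].
    split=> [||//]; first exact: filter_uniq.
    move=> x; rewrite mem_filter => /andP[xA xs].
    by case: (sAB x xs) => // /mem_set; rewrite (negPf xA).
  - by rewrite !big_filter (bigID (mem A)).
move=> [x [y [/subset_sums_seqP[s [us sA ->]] /subset_sums_seqP[t [ut tB ->]] ->]]].
apply/subset_sums_seqP; exists (s ++ t); split; last by rewrite big_cat.
- rewrite cat_uniq us ut andbT; apply/hasPn => z zt; apply/negP => zs.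
  have : (A `&` B) z by split; [apply: sA | apply: tB].
  by rewrite AB0.
- by move=> z; rewrite mem_cat => /orP[/sA|/tB]; [left | right].
Qed.

Lemma subset_sums1 c n : subset_sums [set c] n <-> n = 0 \/ n = c.
Proof.
split=> [/subset_sums_seqP[s [us sc ->]]|].
  case: s us sc => [|x [|y s]] us sc; first by rewrite big_nil; left.
    by rewrite big_seq1 (sc x) ?mem_head //; right.
  move: us; rewrite (sc x) ?mem_head // (sc y) ?inE ?eqxx ?orbT //.
  by rewrite /= inE eqxx.
by case=> ->; apply/subset_sums_seqP; [exists [::] | exists [:: c]];
  split; rewrite ?big_nil ?big_seq1 // => x; rewrite inE => /eqP.
Qed.

Lemma subset_sumsU1 (A : set nat) c n : ~ A c ->
  subset_sums (A `|` [set c]) n <->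
  exists2 x, subset_sums A x & n = x \/ n = x + c.
Proof.
move=> Ac; rewrite subset_sumsU; last first.
  by apply/seteqP; split=> // x [Ax /= xc]; apply: Ac; rewrite -xc.
split=> [[x [y [Ax /subset_sums1 yE ->]]]|[x Ax nE]].
  by exists x => //; case: yE => ->; rewrite ?addn0; [left | right].
by case: nE => ->; exists x; [exists 0 | exists c]; split=> //;
  rewrite ?addn0 //; apply/subset_sums1; [left | right].
Qed.

Lemma subset_sums_sub (A B : set nat) : A `<=` B ->
  subset_sums A `<=` subset_sums B.
Proof. by move=> AB n [S SA ->]; exists S => // x /SA /AB. Qed.

(** Binary expansion of the quotient by [d]. *)
Lemma subset_sums_doublings d n : 0 < d ->
  subset_sums (range (fun i => d * 2 ^ i)) n <-> d %| n.
Proof.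
move=> d0; split=> [/subset_sums_seqP[s [_ sA ->]]|/dvdnP[q ->]].
  rewrite big_seq; apply: (big_ind (fun x => d %| x)) => // [x y|x /sA[i _ <-]].
    exact: dvdn_add.
  exact: dvdn_mulr.
(* Induction on the number [k] of binary digits: the term [d * 2 ^ k] is taken exactly when
   [2 ^ k <= q]. Any [q] fits in [q] digits. *)
suff main k : forall q, q < 2 ^ k ->
    subset_sums [set x | exists2 i, i < k & x = d * 2 ^ i] (q * d).
  have := main q q (@ltn_expl 2 q isT); apply: subset_sums_sub => x [i _ ->].
  by exists i.
elim: k => [|k IHk] {}q.
  rewrite expn0 ltnS leqn0 => /eqP ->; apply/subset_sums_seqP.
  by exists [::]; split; rewrite ?big_nil.
rewrite expnS => qk.
have -> : [set x | exists2 i, i < k.+1 & x = d * 2 ^ i] =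
          [set x | exists2 i, i < k & x = d * 2 ^ i] `|` [set d * 2 ^ k].
  apply/seteqP; split=> x /=.
    move=> [i]; rewrite ltnS leq_eqVlt => /orP[/eqP -> ->|ik ->]; first by right.
    by left; exists i.
  by case=> [[i ik ->]|->]; [exists i => //; lia | exists k].
apply/subset_sumsU1.
  move=> [i ik] /eqP; rewrite eqn_pmul2l // eqn_exp2l //; lia.
have [qk'|kq] := ltnP q (2 ^ k).
  by exists (q * d); [apply: IHk | left].
exists ((q - 2 ^ k) * d); first by apply: IHk; lia.
by right; nia.
Qed.

Lemma set_rcons (s : seq nat) c : [set` rcons s c] = [set` s] `|` [set c].
Proof.
apply/seteqP; split=> x /=; rewrite mem_rcons inE.
  by case/orP=> [/eqP ->|]; [right | left].
by case=> [->|->]; rewrite ?eqxx ?orbT.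
Qed.

Definition complete_list m (s : seq nat) :=
  path ltn 0 s /\ forall n, subset_sums [set` s] n <-> n <= m.

(** Adding [c] joins to the interval [0, k] its translate [c, k + c]; no gap is left because c is at
    most k + 1. *)
Lemma complete_list_rcons k s c :
  complete_list k s -> 0 < c <= k.+1 -> all (ltn^~ c) s ->
  complete_list (k + c) (rcons s c).
Proof.
move=> [ps sE] ck /allP sc; split.
  rewrite rcons_path ps /=.
  by have := mem_last 0 s; rewrite inE => /orP[/eqP->|/sc] //=; lia.
move=> n; rewrite set_rcons subset_sumsU1; last by move=> /sc; rewrite /= ltnn.
split=> [[x /sE xk []]|nkc]; [lia..|].
have [nk|kn] := leqP n k; first by exists n; [apply/sE | left].
by exists (n - c); [apply/sE | right]; lia.
Qed.

Lemma complete_list_nil : complete_list 0 [::].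
Proof.
split=> // n; split=> [/subset_sums_seqP[[|x s] [_ s0 ->]]|].
- by rewrite big_nil.
- by have := s0 x (mem_head _ _).
- rewrite leqn0 => /eqP ->; apply/subset_sums_seqP.
  by exists [::]; split; rewrite ?big_nil.
Qed.

(** Strong induction by halving: a list for [m./2] with entries below [m./2] can be extended by the
    other half [m - m./2]. The strict bound on the entries keeps the extended list strictly
    increasing, even when the two halves are equal. *)
Lemma complete_list_exists m : m \in [:: 3; 6; 7] \/ 10 <= m ->
  exists2 s, complete_list m s & all (ltn^~ m) s.
Proof.
have C3 : complete_list 3 [:: 1; 2].
  apply: (@complete_list_rcons 1 [:: 1] 2) => //.
  exact: (@complete_list_rcons 0 [::] 1 complete_list_nil).
have C6 := @complete_list_rcons 3 _ 3 C3 isT isT.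
have C10 := @complete_list_rcons 6 _ 4 C6 isT isT.
elim/ltn_ind: m => m IHm mE.
(* These are the admissible [m] whose half is 1, 5, 8 or 9, hence not admissible; they get explicit
   lists. *)
have [|mB] := boolP (m \in [:: 3; 10; 11; 16; 17; 18; 19]).
  rewrite !inE; do ?[case/orP]; move=> /eqP ->; eexists.
  - exact: C3.
  - by [].
  - exact: C10.
  - by [].
  - exact: (@complete_list_rcons 6 _ 5 C6).
  - by [].
  - exact: (@complete_list_rcons 10 _ 6 C10).
  - by [].
  - exact: (@complete_list_rcons 10 _ 7 C10).
  - by [].
  - exact: (@complete_list_rcons 10 _ 8 C10).
  - by [].
  - exact: (@complete_list_rcons 10 _ 9 C10).
  - by [].
have [||s Cs /allP sm] := IHm m./2.
- by move: mE; rewrite !inE; lia.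
- by move: mE mB; rewrite !inE; lia.
have mpos : 0 < m./2 by move: mE; rewrite !inE; lia.
have -> : m = m./2 + (m - m./2) by lia.
exists (rcons s (m - m./2)).
  apply: complete_list_rcons => //; first lia.
  by apply/allP => x /sm /=; lia.
by rewrite all_rcons; apply/andP; split; [|apply/allP => x /sm] => /=; lia.
Qed.

(** Turns a finite list followed by an increasing sequence into one increasing enumeration. The
    lower bound [x] carries the induction on [s]; taking [x] to be 0 gives positivity. *)
Lemma prepend_increasing x s (f : nat -> nat) :
  path ltn x (rcons s (f 0)) -> {homo f : m n / m < n} ->
  exists a : nat -> nat,
    [/\ forall n, x < a n, {homo a : m n / m < n}
      & range a = [set` s] `|` range f].
Proof.
move=> + fM; elim: s x => [|y s IHs] x /=.
  rewrite andbT => xf; exists f; split=> //.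
    by case=> // n; exact: ltn_trans xf (fM 0 n.+1 isT).
  by apply/seteqP; split=> z; [right | case].
case/andP=> xy /IHs[a [ya aM aE]].
exists (fun n => if n is n'.+1 then a n' else y); split.
- by case=> // n; exact: ltn_trans xy (ya n).
- by move=> [|m] [|n] // mn; apply: aM.
apply/seteqP; split=> z /=.
  case=> [[|n] _ <-]; first by left; rewrite /= mem_head.
  have : range a (a n) by exists n.
  by rewrite aE /= => -[az|]; [left; rewrite /= inE az orbT | right].
rewrite inE => zE.
have [->|zy] := eqVneq z y; first by exists 0.
have : range a z by rewrite aE; case: zE => [|]; rewrite ?(negPf zy); [left|right].
by case=> n _ <-; exists n.+1.
Qed.

Theorem theorem1p3 (b : nat -> nat) (d : nat)
    (b_arith : forall n : nat, b n = b 0 + n * d)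
    (b0_in : b 0 \in [:: 4; 7; 8] \/ 11 <= b 0)
    (d_bounds : b 0 + 2 <= d <= 2 * b 0 + 1) :
  exists a : nat -> nat,
    [/\ forall n : nat, 0 < a n,
        {homo a : m n / m < n}
      & subset_sums (range a) = [set: nat] `\` range b].
Proof.
have bpos : 0 < b 0 by move: b0_in; rewrite !inE; lia.
have [|s [ps sE] /allP sb] := @complete_list_exists (b 0).-1.
  by move: b0_in; rewrite !inE; lia.
pose f i := d * 2 ^ i.
have fM : {homo f : m n / m < n}.
  by move=> m n mn; rewrite ltn_pmul2l ?ltn_exp2l //; lia.
have df i : d <= f i by rewrite leq_pmulr // expn_gt0.
(* The order is right: entries of [s] are below b - 1, then come b + 1 and [f 0], which is d, at
   least b + 2. *)
have [|a [apos aM aE]] := @prepend_increasing 0 (rcons s (b 0).+1) f _ fM.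
  rewrite !rcons_path ps last_rcons /=; apply/andP; split; last first.
    by have := df 0; lia.
  by have := mem_last 0 s; rewrite inE => /orP[/eqP->|/sb] //=; lia.
exists a; split=> //; rewrite {}aE set_rcons.
have disj : ([set` s] `|` [set (b 0).+1]) `&` range f = set0.
  apply/seteqP; split=> // x [] /= /[swap] -[i _ <-].
  by have := df i; move=> ? [/sb /=|]; lia.
apply/seteqP; split=> n; rewrite (@subset_sumsU _ _ _ disj).
- move=> [x [y [+ /subset_sums_doublings yd ->]]].
  rewrite subset_sumsU1; last by move=> /sb /=; lia.
  move=> [z /sE zb xE]; split=> // -[i _]; rewrite b_arith.
  have /dvdnP[q ->] : d %| y by apply: yd; lia.
  (* Here x lies in [0, 2b] and differs from b, so its distance to b is at most b < d. Hence x + qd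
     = b + id is impossible, whether or not i = q. *)
  have [iq|qi|->] := ltngtP i q; last by case: xE => ->; lia.
    by have := leq_mul iq (leqnn d); case: xE => ->; lia.
  by have := leq_mul qi (leqnn d); case: xE => ->; lia.
- move=> [_ nb]; exists (n %% d), (n %/ d * d); split; last by lia.
    apply/subset_sumsU1; first by move=> /sb /=; lia.
    (* A remainder below b is a sum from [s] alone. One above b is at most d - 1, so at most 2b, and
       subtracting b + 1 leaves at most b - 1. *)
    have [nlt|nge] := ltnP (n %% d) (b 0).
      by exists (n %% d); [apply/sE; lia | left].
    have nneq : n %% d <> b 0.
      move=> nE; apply: nb; exists (n %/ d) => //.
      by rewrite b_arith -nE addnC -divn_eq.
    have : n %% d < d by rewrite ltn_mod; lia.
    by exists (n %% d - (b 0).+1); [apply/sE | right]; lia.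
  by apply/subset_sums_doublings; [lia | exact: dvdn_mull].
Qed.
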